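(* Let $n$ and $k$ be positive integers. If $n\equiv 0,1\pmod 4$ and $n\ge 2k+6$, or if $n\equiv 2,3\pmod 4$ and $n\ge 2k+4$, then for each choice of sign $\epsilon\in\{+,-\}$, $$1^kR^{\epsilon}_{n,1}+3^kR^{\epsilon}_{n,3}+5^kR^{\epsilon}_{n,5}+\cdots=2^kR^{\epsilon}_{n,2}+4^kR^{\epsilon}_{n,4}+6^kR^{\epsilon}_{n,6}+\cdots.$$
   Context: For $\pi=\pi_1\cdots\pi_n\in\mathfrak{S}_n$, let $\mathrm{inv}(\pi)=|\{i<j:\pi_i>\pi_j\}|$; let $\mathrm{pk}(\pi)$ (resp. $\mathrm{val}(\pi)$) be the number of indices $2\le i\le n-1$ with $\pi_{i-1}<\pi_i>\pi_{i+1}$ (resp. $\pi_{i-1}>\pi_i<\pi_{i+1}$), and $\mathrm{altruns}(\pi)=\mathrm{pk}(\pi)+\mathrm{val}(\pi)+1$. Let $\mathcal{A}_n$ be the set of permutations with an even number of inversions. Let $R^+_{n,j}$ be the number of $\pi\in\mathcal{A}_n$ with $\mathrm{altruns}(\pi)=j$, and $R^-_{n,j}$ the number of $\pi\in\mathfrak{S}_n\setminus\mathcal{A}_n$ with $\mathrm{altruns}(\pi)=j$. *)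

(* Defs.v *)
From mathcomp Require Import all_boot all_fingroup.

Set Implicit Arguments.
Unset Strict Implicit.
Unset Printing Implicit Defensive.

(* A permutation s : 'S_n stands for the word s 0, ..., s (n - 1); positions   *)
(* and values are numbered from 0 instead of 1.                                *)

Definition inv n (s : 'S_n) : nat :=
  #|[set p : 'I_n * 'I_n | (p.1 < p.2) && (s p.2 < s p.1)]|.

(* Requiring both neighbours a and b of i to exist is what restricts i to the  *)
(* interior positions.                                                         *)
Definition peaks n (s : 'S_n) : {set 'I_n} :=
  [set i : 'I_n | [exists a : 'I_n, exists b : 'I_n,
     [&& a.+1 == i :> nat, i.+1 == b :> nat, s a < s i & s b < s i]]].

Definition valleys n (s : 'S_n) : {set 'I_n} :=
  [set i : 'I_n | [exists a : 'I_n, exists b : 'I_n,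
     [&& a.+1 == i :> nat, i.+1 == b :> nat, s i < s a & s i < s b]]].

Definition pk n (s : 'S_n) : nat := #|peaks s|.
Definition vl n (s : 'S_n) : nat := #|valleys s|.

Definition altruns n (s : 'S_n) : nat := pk s + vl s + 1.

Definition even_perms n : {set 'S_n} := [set s : 'S_n | ~~ odd (inv s)].

(* eps = true is the sign +, eps = false the sign -.                           *)
Definition signed_perms (eps : bool) n : {set 'S_n} :=
  if eps then even_perms n else ~: even_perms n.

Definition R (eps : bool) (n j : nat) : nat :=
  #|[set s in signed_perms eps n | altruns s == j]|.

Lemma altruns_le n (s : 'S_n) : 0 < n -> altruns s <= n.
Proof.
case: n s => // n s _; rewrite /altruns addn1 ltnS.
have dis : peaks s :&: valleys s = set0.
  apply/setP=> i; rewrite !inE; apply/negP => /andP[].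
  case/existsP=> a /existsP[b /and4P[/eqP ai _ sai _]].
  case/existsP=> c /existsP[d /and4P[/eqP ci _ sic _]].
  have ac : a = c by apply: val_inj; apply: succn_inj; rewrite /= ai ci.
  by move: sai; rewrite ac ltnNge ltnW.
have -> : pk s + vl s = #|peaks s :|: valleys s|.
  by rewrite cardsU dis cards0 subn0.
have cn : #|[set~ (ord0 : 'I_n.+1)]| = n by rewrite cardsC1 card_ord.
rewrite -[leqRHS]cn; apply/subset_leq_card/subsetP=> i; rewrite !inE => /orP[] /existsP[a] /existsP[b];
  by case/and4P=> /eqP ai _ _ _; apply: contra_eqN ai => /eqP->.
Qed.

(* Hence a sum over all j >= 1 may stop at j = n.                              *)
Lemma R_out eps n j : 0 < n -> n < j -> R eps n j = 0.
Proof.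
move=> n0 nj; apply/eqP; rewrite cards_eq0; apply/eqP/setP=> s; rewrite !inE.
by apply/negP=> /andP[_ /eqP js]; move: (altruns_le s n0); rewrite js leqNgt nj.
Qed.

(* Main.v *)
From mathcomp Require Import all_boot all_fingroup all_order all_algebra zify.
Require Import Defs.

(* Let P(t) be the sum of t^altruns(s) over all s, and Q(t) the same sum       *)
(* weighted by (-1)^inv(s); the two signs have generating functions            *)
(* (P + Q) / 2 and (P - Q) / 2.  The claim says that (t d/dt)^k kills both at  *)
(* t = -1, so it is enough that (1 + t)^(k+1) divides P and Q.                 *)
(*                                                                             *)
(* P: reversing the order of the values in positions i, ..., n - 1 (an idea of *)
(* Bona) toggles the turn at exactly one of the positions i - 1, i and changes *)
(* no other turn.  These involutions for i = 2, 4, 6, ... commute, so every    *)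
(* orbit contributes a multiple of (1 + t)^(n/2 - 1).                          *)
(*                                                                             *)
(* Q: swapping the values 2i and 2i + 1 changes the sign.  If they are not in  *)
(* adjacent positions, no turn changes and the contributions cancel; if they   *)
(* are, and neither is at an end of the word, exactly the two turns at their   *)
(* positions toggle, which gives a factor 0 or +-(1 - t^2).  At most two pairs *)
(* touch an end, so (1 + t)^(n/2 - 2) divides Q.  When n = 2, 3 mod 4,         *)
(* complementing all values preserves altruns and changes the sign: Q = 0.     *)

Set Implicit Arguments.
Unset Strict Implicit.
Unset Printing Implicit Defensive.
Import GRing.Theory Num.Theory.

(** Both divisibilities are instances of [sum_prod_orbit]: the weight of a permutation factors over
    the index i, the i-th involution changes only the i-th factor, and averaging turns that factor
    into a multiple of 1 + t. [dvdp_sum_altruns] takes the multiplier e = 1, and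
    [dvdp_sum_signed_altruns] takes e = -1 because each swap of values flips the sign. With n/2
    rounded down, the exponents n/2 - 1 and n/2 - 2 reach k + 1 when n >= 2k + 4 and n >= 2k + 6
    respectively. [sum_signed_pow_eq0] turns divisibility into vanishing moments, and [sum_R]
    recovers the two sign classes from P and Q. *)

(** * Averaging over commuting maps, and divisibility by powers of 1 + t *)

Section Algebra.
Local Open Scope ring_scope.

(* Averaging over one involution g i at a time; G absorbs the factors that     *)
(* have already been averaged.                                                 *)
Lemma sum_prod_orbit (A : comPzRingType) (T I : finType) (e : A)
    (g : I -> T -> T) (F : I -> T -> A) (G : T -> A) :
  (forall i, injective (g i)) ->
  (forall i j x, g i (g j x) = g j (g i x)) ->
  (forall i j x, j != i -> F j (g i x) = F j x) ->
  (forall i x, G (g i x) = e * G x) ->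
  (\sum_x G x * \prod_i F i x) *+ 2 ^ #|I| =
  \sum_x G x * \prod_i (F i x + e * F i (g i x)).
Proof.
move=> g_inj gC FE GE.
suff {G GE} orb (s : seq I) (G : T -> A) : uniq s ->
    (forall i x, i \in s -> G (g i x) = e * G x) ->
    (\sum_x G x * \prod_(i <- s) F i x) *+ 2 ^ size s =
    \sum_x G x * \prod_(i <- s) (F i x + e * F i (g i x)).
  have := orb (index_enum I) G (index_enum_uniq I) (fun i x _ => GE i x).
  by rewrite -[size _]/(size (index_enum I)) -[index_enum I]enumT -cardE.
elim: s G => [|i s IHs] G /= => [_ _|/andP[i_s s_uniq] GE].
  by rewrite mulr1n; apply: eq_bigr => x _; rewrite !big_nil.
have GEi x : G (g i x) = e * G x by rewrite GE ?mem_head.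
have Fs x : \prod_(j <- s) F j (g i x) = \prod_(j <- s) F j x.
  by apply: eq_big_seq => j js; apply: FE; apply: contraNneq i_s => <-.
have step : (\sum_x G x * \prod_(j <- i :: s) F j x) *+ 2 =
    \sum_x G x * (F i x + e * F i (g i x)) * \prod_(j <- s) F j x.
  rewrite mulr2n [X in _ + X](reindex_inj (g_inj i)) -big_split /=.
  apply: eq_bigr => x _; rewrite !big_cons Fs GEi mulrDr mulrDl !mulrA.
  by rewrite [e * G x]mulrC.
rewrite expnS mulrnA step IHs //.
  by apply: eq_bigr => x _; rewrite big_cons mulrA.
(* The enlarged G is still multiplied by e under g j: its new factor involves only F i, at x and at
   g i x, and g j commutes with g i. *)
move=> j x js; have ij : i != j by apply: contraNneq i_s => ->.
by rewrite GE ?inE ?js ?orbT // gC !(FE _ _ _ ij) mulrA.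
Qed.

Local Notation q := ('X - (-1)%:P : {poly rat}).

Lemma dvdp_exp_prod (I : finType) (F : I -> {poly rat}) (P : pred I) :
  (forall i, P i -> q %| F i) -> q ^+ #|P| %| \prod_i F i.
Proof.
move=> dvdF; rewrite (bigID P) /= dvdp_mulr //.
rewrite -prodr_const; elim/big_rec2: _ => // i a b Pi; apply: dvdp_mul.
exact: dvdF.
Qed.

Lemma dvdp_XnDXn a b : odd (a + b) -> q %| 'X^a + 'X^b.
Proof.
rewrite oddD dvdp_XsubCl rootE !hornerE => /addbP ab.
by rewrite -(signr_odd _ a) -(signr_odd _ b) -ab; case: (odd a).
Qed.

Lemma dvdp_XnBXn a b : ~~ odd (a + b) -> q %| 'X^a - 'X^b.
Proof.
rewrite oddD dvdp_XsubCl rootE !hornerE negb_add => /eqP ab.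
by rewrite -(signr_odd _ a) -(signr_odd _ b) ab subrr.
Qed.

Lemma dvdp_exp_Xderiv m (p : {poly rat}) :
  q ^+ m.+1 %| p -> q ^+ m %| 'X * p^`().
Proof.
case/dvdpP=> r ->; rewrite derivM deriv_exp dvdp_mull // dvdp_add //.
  by rewrite exprS mulrA dvdp_mulIr.
by rewrite -mulrnAl mulrA dvdp_mulIr.
Qed.

(** Each application of t d/dt costs at most one factor 1 + t and multiplies the coefficient c x by
    a x; hence the induction on k for all c at once, ending with evaluation at -1. *)
Lemma sum_signed_pow_eq0 (T : finType) (c : T -> rat) (a : T -> nat) k :
  q ^+ k.+1 %| \sum_x c x *: 'X^(a x) ->
  \sum_x c x * (-1) ^+ a x * (a x)%:R ^+ k = 0.
Proof.
elim: k c => [|k IHk] c.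
  rewrite expr1 dvdp_XsubCl rootE horner_sum => /eqP S0.
  by rewrite -[RHS]S0; apply: eq_bigr => x _; rewrite !hornerE.
move/dvdp_exp_Xderiv; rewrite linear_sum mulr_sumr => dvdk.
rewrite -[RHS](IHk (fun x => c x * (a x)%:R)).
  by apply: eq_bigr => x _; rewrite exprS mulrA [_ * _%:R]mulrAC.
rewrite [X in _ %| X](eq_bigr (fun x => 'X * (c x *: 'X^(a x))^`())) // => x _.
rewrite derivZ derivXn -scalerAr; case: (a x) => [|b].
  by rewrite mulr0n !mulr0 scaler0 scale0r.
by rewrite ['X * _]mulrnAr -exprS -scaler_nat scalerA.
Qed.
End Algebra.

(** * Order reversal of a set of values *)

Section Reverse.
Variable n : nat.
Implicit Types (A B : {set 'I_n}) (u v : 'I_n).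

Definition rev_in A v : 'I_n :=
  if v \in A then nth v (enum A) (size (enum A) - (index v (enum A)).+1) else v.

Lemma rev_in_mem A v : (rev_in A v \in A) = (v \in A).
Proof.
rewrite /rev_in; case: ifP => // Av.
by rewrite -mem_enum mem_nth // ltn_subrL -has_predT; apply/hasP; exists v; rewrite ?mem_enum.
Qed.

Lemma rev_inK A : involutive (rev_in A).
Proof.
move=> v; rewrite {1}/rev_in rev_in_mem; case: ifP => Av; last by rewrite /rev_in Av.
rewrite /rev_in Av; set s := enum A.
have vs : index v s < size s by rewrite index_mem mem_enum.
rewrite index_uniq ?enum_uniq ?ltn_subrL ?(leq_trans _ vs) //.
rewrite -subSn // subnS /= subKn ?(ltnW vs) // (set_nth_default v) //.
by rewrite nth_index // mem_enum.
Qed.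

Definition rev_perm A : 'S_n := perm (can_inj (@rev_inK A)).

Lemma rev_perm_out A v : v \notin A -> rev_perm A v = v.
Proof. by rewrite permE /rev_in => /negPf->. Qed.

Lemma rev_perm_mem A v : (rev_perm A v \in A) = (v \in A).
Proof. by rewrite permE rev_in_mem. Qed.

Lemma rev_permK A : (rev_perm A * rev_perm A = 1)%g.
Proof. by apply/permP=> v; rewrite permM !permE rev_inK. Qed.

Lemma index_enum_ord A u v :
  u \in A -> v \in A -> (index u (enum A) < index v (enum A)) = (u < v).
Proof.
move=> Au Av.
have srt : sorted (fun i j : 'I_n => i < j) (enum A).
  rewrite /enum_mem -enumT; apply: sorted_filter; first exact: ltn_trans.
  by have := iota_ltn_sorted 0 n; rewrite -val_enum_ord sorted_map.
have H (a b : 'I_n) : a \in A -> b \in A ->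
    index a (enum A) < index b (enum A) -> a < b.
  move=> Aa Ab lt_ab.
  have := sorted_ltn_nth (fun _ _ _ => @ltn_trans _ _ _) a srt.
  move/(_ (index a (enum A)) (index b (enum A))).
  by rewrite !inE !index_mem !mem_enum Aa Ab !nth_index ?mem_enum //; apply.
case: (ltngtP (index u (enum A))) => [/(H _ _ Au Av)->//|/(H _ _ Av Au) vu|].
  by rewrite ltnNge (ltnW vu).
move/(congr1 (nth u (enum A))); rewrite !nth_index ?mem_enum // => ->.
by rewrite ltnn.
Qed.

Lemma rev_perm_lt A u v :
  u \in A -> v \in A -> (rev_perm A u < rev_perm A v) = (v < u).
Proof.
move=> Au Av; rewrite -[RHS](index_enum_ord Av Au).
rewrite -(@index_enum_ord A) ?rev_perm_mem // !permE /rev_in Au Av.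
have us : index u (enum A) < size (enum A) by rewrite index_mem mem_enum.
have vs : index v (enum A) < size (enum A) by rewrite index_mem mem_enum.
rewrite !index_uniq ?enum_uniq // ?ltn_subrL ?(leq_trans _ us) //; lia.
Qed.

(** Let v be the least point moved. Its image and its preimage are moved too, so both exceed v, and
    then h reverses the order of v and its preimage. *)
Lemma perm_on_mono_eq1 A (h : 'S_n) :
  (forall v, v \notin A -> h v = v) ->
  (forall u v, u \in A -> v \in A -> u < v -> h u < h v) -> h = 1%g.
Proof.
move=> h_out h_mono; apply/permP=> v; rewrite perm1.
have [m] := ubnP v; elim: m v => // m IHm v /ltnSE le_vm.
apply/eqP/negPn/negP=> hv.
have Av : v \in A by apply: contraR hv => /h_out->.
have fixA w : h w != w -> w \in A by move=> hw; apply: contraR hw => /h_out->.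
have hhv : h (h v) != h v by rewrite (inj_eq perm_inj).
case: (ltngtP (h v) v) => [lt|gt|/val_inj/eqP]; last by rewrite (negPf hv).
  by move/eqP: hhv; apply; apply: IHm; apply: leq_trans lt le_vm.
set u := h^-1%g v; have hu : h u = v by rewrite permKV.
have uv : u != v by apply: contra hv => /eqP {1}<-; rewrite hu.
have Au : u \in A by apply: fixA; rewrite hu eq_sym.
case: (ltngtP u v) => [lt|lt|/val_inj/eqP]; last by rewrite (negPf uv).
  have /eqP := IHm u (leq_trans lt le_vm); by rewrite hu eq_sym (negPf uv).
by have := h_mono _ _ Av Au lt; rewrite hu ltnNge (ltnW gt).
Qed.

(** Composing two order reversals of A gives an increasing permutation of A, which is the identity.
    Later arguments can thus avoid the indices in [rev_in]. *)
Lemma rev_perm_unique A (f : 'S_n) :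
  (forall v, v \notin A -> f v = v) ->
  (forall u v, u \in A -> v \in A -> u < v -> f v < f u) -> f = rev_perm A.
Proof.
move=> f_out f_rev.
have fA v : v \in A -> f v \in A.
  by move=> Av; apply: contraLR Av => fv; rewrite -(perm_inj (f_out _ fv)).
suff: (f * rev_perm A = 1)%g.
  by move/(canRL (mulgK _)); rewrite mul1g => ->; apply/eqP; rewrite eq_invg_mul rev_permK.
apply: (@perm_on_mono_eq1 A) => [v Av|u v Au Av uv]; rewrite !permM.
  by rewrite f_out // rev_perm_out.
by rewrite rev_perm_lt ?fA // f_rev.
Qed.

(** The conjugate reverses the image of B, since [rev_perm A] flips the order inside A twice. This
    is what makes the suffix reversals commute. *)
Lemma rev_perm_imset A B :
  B \subset A -> (rev_perm (rev_perm A @: B) = rev_perm B ^ rev_perm A)%g.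
Proof.
move=> /subsetP sBA; apply/esym/rev_perm_unique => [v|_ _ /imsetP[u Bu ->] /imsetP[v Bv ->]].
  rewrite -[v](permKV (rev_perm A)) mem_imset ?permJ; last exact: perm_inj.
  by move/rev_perm_out->.
by rewrite !permJ !rev_perm_lt ?sBA ?rev_perm_mem.
Qed.

Lemma rev_perm_stable A B : A \subset B -> rev_perm A @: B = B.
Proof.
move/subsetP=> sAB; apply/eqP; rewrite eqEcard card_imset ?leqnn ?andbT; last exact: perm_inj.
apply/subsetP=> _ /imsetP[v Bv ->].
by have [Av|/rev_perm_out->//] := boolP (v \in A); rewrite sAB ?rev_perm_mem.
Qed.

End Reverse.

(** * Turns, suffix reversals and the divisibility of P *)

Section Runs.
Variable N : nat.
Implicit Types (x : 'S_N.+1) (p i : nat).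

(* Positions are plain numbers here; the values at p >= N are junk, which the  *)
(* bounds in turn exclude.                                                     *)
Definition asc x p : bool := x (inord p) < x (inord p.+1).

Definition turn x p : bool := [&& 0 < p, p < N & asc x p.-1 (+) asc x p].

Lemma perm_ltNge x (a b : 'I_N.+1) : a != b -> (x b < x a) = ~~ (x a < x b).
Proof.
move=> ab; rewrite -leqNgt [RHS]leq_eqVlt.
by rewrite (inj_eq (@ord_inj _)) (inj_eq perm_inj) eq_sym (negPf ab).
Qed.

Lemma inord_neqS p : p < N -> inord p != inord p.+1 :> 'I_N.+1.
Proof. by move=> pN; rewrite -val_eqE /= !inordK ?ltnS //; lia. Qed.

Lemma descE x p : p < N -> (x (inord p.+1) < x (inord p)) = ~~ asc x p.
Proof. by move=> pN; rewrite perm_ltNge ?inord_neqS. Qed.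

Lemma in_peaks x (i : 'I_N.+1) :
  (i \in peaks x) = [&& 0 < i, i < N, asc x i.-1 & ~~ asc x i].
Proof.
rewrite inE; apply/existsP/and4P => [[a /existsP[b /and4P[/eqP ai /eqP ib sa sb]]]|[i0 iN ai aNi]].
  have iN : i < N by rewrite -ltnS ib.
  have i0 : 0 < i by rewrite -ai.
  by split=> //; rewrite -?descE // /asc -?ai /= ?ai ?ib !inord_val.
exists (inord i.-1); apply/existsP; exists (inord i.+1).
move: ai aNi; rewrite -descE // /asc prednK // inord_val => -> ->.
by rewrite !inordK ?prednK ?eqxx //; lia.
Qed.

Lemma in_valleys x (i : 'I_N.+1) :
  (i \in valleys x) = [&& 0 < i, i < N, ~~ asc x i.-1 & asc x i].
Proof.
rewrite inE; apply/existsP/and4P => [[a /existsP[b /and4P[/eqP ai /eqP ib sa sb]]]|[i0 iN aNi ai]].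
  have iN : i < N by rewrite -ltnS ib.
  have i0 : 0 < i by rewrite -ai.
  have iN' : i.-1 < N by apply: leq_ltn_trans (leq_pred _) iN.
  by split=> //; rewrite -?descE // /asc -?ai /= ?ai ?ib !inord_val.
exists (inord i.-1); apply/existsP; exists (inord i.+1).
have iN' : i.-1 < N by apply: leq_ltn_trans (leq_pred _) iN.
move: aNi ai; rewrite -descE // /asc prednK // inord_val => -> ->.
by rewrite !inordK ?prednK ?eqxx //; lia.
Qed.

Lemma altruns_turns x : altruns x = (\sum_(p < N.+1) turn x p).+1.
Proof.
rewrite /altruns addn1 /pk /vl -!sum1_card big_mkcond [X in _ + X]big_mkcond -big_split /=.
congr _.+1; apply: eq_bigr => i _; rewrite in_peaks in_valleys /turn.
by case: (0 < i) (i < N) (asc x i.-1) (asc x i) => [] [] [] [].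
Qed.

Lemma sum_turn_widen x M : N <= M ->
  \sum_(p < N.+1) turn x p = \sum_(p < M) turn x p.
Proof.
move=> NM; rewrite -!(big_mkord xpredT (fun p => turn x p : nat)).
rewrite big_nat_recr //= {2}/turn ltnn andbF addn0.
rewrite [RHS](@big_cat_nat _ _ _ N) //= [X in _ + X]big1_seq ?addn0 // => p.
by rewrite mem_index_iota /turn [p < N]ltnNge => /andP[_ /andP[-> _]]; rewrite andbF.
Qed.

Lemma sum_double (f : nat -> nat) m :
  \sum_(p < m.*2) f p = \sum_(i < m) (f i.*2 + f i.*2.+1).
Proof.
elim: m => [|m IHm]; first by rewrite !big_ord0.
by rewrite doubleS !big_ord_recr /= IHm addnA.
Qed.

Definition suffix i : {set 'I_N.+1} := [set p : 'I_N.+1 | i <= p].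

(** The product applies x first, so values are reversed rather than positions: the suffix keeps its
    set of values, and the largest of them trades places with the smallest. *)
Definition rev_suffix i x : 'S_N.+1 := (x * rev_perm (x @: suffix i))%g.

Lemma imset_permM x y (A : {set 'I_N.+1}) : (x * y)%g @: A = y @: (x @: A).
Proof. by rewrite (eq_imset A (permM x y)) imset_comp. Qed.

Lemma imset_rev_suffix i j x :
  i <= j -> rev_suffix j x @: suffix i = x @: suffix i.
Proof.
move=> ij.
rewrite imset_permM rev_perm_stable // imsetS //.
by apply/subsetP=> p; rewrite !inE; apply: leq_trans.
Qed.

Lemma rev_suffixK i : involutive (rev_suffix i).
Proof.
by move=> x; rewrite {1}/rev_suffix imset_rev_suffix // -mulgA rev_permK mulg1.
Qed.

(** For i <= j let B inside A be the value sets of the two suffixes. Reversing A first moves B to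
    its mirror image in A, whose reversal is the conjugate of that of B; the conjugating factors
    cancel. *)
Lemma rev_suffixC i j x :
  rev_suffix i (rev_suffix j x) = rev_suffix j (rev_suffix i x).
Proof.
wlog ij : i j / i <= j => [sym|].
  by case/orP: (leq_total i j) => ij; [|apply/esym]; apply: sym.
rewrite {1}/rev_suffix imset_rev_suffix // /rev_suffix.
rewrite imset_permM.
rewrite rev_perm_imset /conjg; last first.
  by apply: imsetS; apply/subsetP=> p; rewrite !inE; apply: leq_trans.
by rewrite !mulgA mulgK.
Qed.

Lemma rev_suffix_out i x (p : 'I_N.+1) : p < i -> rev_suffix i x p = x p.
Proof.
move=> pi; rewrite permM rev_perm_out //.
by rewrite mem_imset ?inE -?ltnNge //; apply: perm_inj.
Qed.

Lemma asc_rev_suffix_lt i x p : p.+1 < i -> p < N -> asc (rev_suffix i x) p = asc x p.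
Proof. by move=> pi pN; rewrite /asc !rev_suffix_out ?inordK ?ltnS //; lia. Qed.

Lemma asc_rev_suffix_ge i x p :
  i <= p -> p < N -> asc (rev_suffix i x) p = ~~ asc x p.
Proof.
move=> ip pN; rewrite -descE // /asc !permM rev_perm_lt //.
all: by apply: imset_f; rewrite inE inordK ?ltnS //; lia.
Qed.

Lemma turn_rev_suffix i x p : p.+1 < i \/ i < p ->
  turn (rev_suffix i x) p = turn x p.
Proof.
rewrite /turn; case: (posnP p) => // p0; case: (ltnP p N) => //= pN.
case=> [pi|ip]; first by rewrite !asc_rev_suffix_lt //; lia.
by rewrite !asc_rev_suffix_ge ?addbN ?addNb ?negbK //; lia.
Qed.

(** The comparison across the cut, at position i, may or may not change, but it enters both turns
    and cancels mod 2. Of the other two comparisons, only the one at i + 1 flips. *)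
Lemma odd_turns_rev_suffix i x : 0 < i -> i.+1 < N ->
  odd (turn x i + turn x i.+1) =
  ~~ odd (turn (rev_suffix i.+1 x) i + turn (rev_suffix i.+1 x) i.+1).
Proof.
move=> i0 iN; have iN' := ltnW iN.
rewrite !oddD !oddb /turn i0 iN iN' /=.
rewrite (@asc_rev_suffix_lt _ _ i.-1) ?(@asc_rev_suffix_ge _ _ i.+1) //; lia.
Qed.

Local Open Scope ring_scope.
Local Notation q := ('X - (-1)%:P : {poly rat}).

Lemma dvdp_sum_altruns : q ^+ (N.+1)./2.-1 %| \sum_(x : 'S_N.+1) 'X^(altruns x).
Proof.
set m := (N.+1)./2.-1.
(* Position 0 is never a turn, so pairing starts at 1. The unpaired position 2m + 1 goes into G with
   the extra 1 of [altruns]; it is interior exactly when n is odd and at least 3. *)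
pose F (j : 'I_m) x : {poly rat} := 'X^(turn x j.*2.+1 + turn x j.*2.+2).
pose G x : {poly rat} := 'X^((turn x m.*2.+1).+1).
have mN (j : 'I_m) : (j.*2.+2 < N)%N by have := ltn_ord j; rewrite /m; lia.
have XE x : 'X^(altruns x) = G x * \prod_j F j x.
  rewrite altruns_turns (@sum_turn_widen _ m.*2.+2); last by rewrite /m; lia.
  rewrite big_ord_recl big_ord_recr /= add0n.
  rewrite (sum_double (fun p => turn x p.+1)) -addnS exprD mulrC; congr (_ * _).
  by rewrite expr_sum.
have := @sum_prod_orbit _ _ _ 1 (fun (j : 'I_m) => rev_suffix j.*2.+2) F G.
rewrite -(eq_bigr _ (fun x _ => XE x)) => orb.
suff: q ^+ m %| (\sum_(x : 'S_N.+1) 'X^(altruns x)) *+ 2 ^ #|'I_m|.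
  by rewrite -scaler_nat dvdpZr // pnatr_eq0 -lt0n expn_gt0.
rewrite orb => [|j|i j x|i j x ij|i x].
- elim/big_ind: _ => [|a b|x _]; [exact: dvdp0|exact: dvdp_add|apply: dvdp_mull].
  rewrite -[X in q ^+ X]card_ord; apply: dvdp_exp_prod => j _.
  rewrite mul1r; apply: dvdp_XnDXn.
  by rewrite oddD odd_turns_rev_suffix ?mN // addNb addbb.
- exact: inv_inj (@rev_suffixK _).
- exact: rev_suffixC.
- have {}ij : j <> i :> nat by move=> ji; case/eqP: ij; apply: val_inj.
  by rewrite /F !turn_rev_suffix //; lia.
- rewrite /G mul1r turn_rev_suffix //; have := ltn_ord i; lia.
Qed.

End Runs.

(** * Swaps of consecutive values and the divisibility of Q *)

Section Sign.
Variable N : nat.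
Implicit Types (x y : 'S_N.+1) (p i v : nat).

(** Here d marks the pairs of positions whose relative order differs between x and y. *)
Lemma odd_inv_addb x y (d : 'I_N.+1 -> 'I_N.+1 -> bool) :
  (forall a b : 'I_N.+1, a < b -> (y b < y a) = (x b < x a) (+) d a b) ->
  odd (inv y) = odd (inv x) (+) odd (\sum_(p : 'I_N.+1 * 'I_N.+1 | p.1 < p.2) d p.1 p.2).
Proof.
move=> yx.
have invE z : inv z = \sum_(p : 'I_N.+1 * 'I_N.+1 | p.1 < p.2) (z p.2 < z p.1).
  rewrite /inv -sum1_card big_mkcond [RHS]big_mkcond /=.
  by apply: eq_bigr => p _; rewrite inE; case: (p.1 < p.2) => //=; case: ltnP.
rewrite !invE.
elim/big_rec3: _ => // p a b c p12; rewrite !oddD !oddb => ->.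
by rewrite yx // -!addbA; congr (_ (+) _); rewrite addbCA.
Qed.

Definition swap_values v x : 'S_N.+1 := (x * tperm (inord v) (inord v.+1))%g.

Definition pos x v : 'I_N.+1 := (x^-1)%g (inord v).

Lemma pos_eq x v (a : 'I_N.+1) : v <= N -> (x a == v :> nat) = (a == pos x v).
Proof.
move=> vN; rewrite -[a in RHS](permK x) (inj_eq perm_inj) -val_eqE /=.
by rewrite inordK.
Qed.

Lemma tperm_succ_lt v (a b : 'I_N.+1) : v < N -> a != b ->
  (tperm (inord v) (inord v.+1) a < tperm (inord v) (inord v.+1) b) =
  (a < b) (+) ((a == v :> nat) && (b == v.+1 :> nat) || (a == v.+1 :> nat) && (b == v :> nat)).
Proof.
move=> vN; rewrite -val_eqE /=.
have vE : (inord v : 'I_N.+1) = v :> nat by rewrite inordK // ltnW.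
have v1E : (inord v.+1 : 'I_N.+1) = v.+1 :> nat by rewrite inordK.
case: tpermP => [->|->|/eqP + /eqP];
  case: tpermP => [->|->|/eqP + /eqP]; rewrite -?val_eqE /= ?vE ?v1E; lia.
Qed.

Lemma swap_values_lt v x (a b : 'I_N.+1) : v < N -> a != b ->
  (swap_values v x a < swap_values v x b) =
  (x a < x b) (+) ((a == pos x v) && (b == pos x v.+1) || (a == pos x v.+1) && (b == pos x v)).
Proof.
move=> vN ab; rewrite !permM tperm_succ_lt ?(inj_eq perm_inj) //.
by rewrite !pos_eq // ltnW.
Qed.

Lemma pos_neqS x v : v < N -> pos x v != pos x v.+1.
Proof. by move=> vN; rewrite (inj_eq perm_inj) inord_neqS. Qed.

Lemma odd_inv_swap_values v x : v < N -> odd (inv (swap_values v x)) = ~~ odd (inv x).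
Proof.
move=> vN.
pose d (b a : 'I_N.+1) := ((a == pos x v) && (b == pos x v.+1) || (a == pos x v.+1) && (b == pos x v)).
rewrite (@odd_inv_addb x _ d) => [|a b ab]; last first.
  by rewrite swap_values_lt // -val_eqE /= neq_ltn ab orbT.
rewrite -addbT; congr (_ (+) _).
have pq := pos_neqS x vN.
(* The only pair whose order changes, listed with its smaller position first. *)
pose r := if pos x v < pos x v.+1 then (pos x v, pos x v.+1) else (pos x v.+1, pos x v).
rewrite (bigD1 r) /=; last first.
  by rewrite /r; case: (ltngtP (pos x v) (pos x v.+1)) pq => [||/ord_inj->] //; rewrite eqxx.
rewrite big1 ?addn0 => [|[a b] /= /andP[ab nr]].
  by rewrite /d /r; case: ifP; rewrite /= !eqxx ?orbT.
apply/eqP; rewrite eqb0 /d; apply: contra nr => /orP[] /andP[/eqP bE /eqP aE].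
  by rewrite /r -aE -bE ltnNge (ltnW ab).
by rewrite /r -aE -bE ab.
Qed.

Lemma asc_swap_values v x p : v < N -> p < N ->
  asc (swap_values v x) p =
  asc x p (+) ((p == pos x v :> nat) && (p.+1 == pos x v.+1 :> nat) ||
               (p == pos x v.+1 :> nat) && (p.+1 == pos x v :> nat)).
Proof.
move=> vN pN; rewrite /asc swap_values_lt ?inord_neqS // -!val_eqE /=.
by rewrite !inordK // ltnW.
Qed.

Lemma turn_swap_values v x p : v < N -> p != pos x v :> nat -> p != pos x v.+1 :> nat ->
  turn (swap_values v x) p = turn x p.
Proof.
move=> vN /negPf pv /negPf pv1; rewrite /turn.
case: (posnP p) => // p0; case: (ltnP p N) => //= pN.
have pN' : p.-1 < N by lia.
by rewrite !asc_swap_values // prednK // pv pv1 !andbF !addbF.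
Qed.

(** If a and b are adjacent, the comparison between them flips and enters both turns; otherwise no
    comparison flips. *)
Lemma odd_turns_swap_values v x (a := pos x v) (b := pos x v.+1) :
    v < N -> 0 < a < N -> 0 < b < N ->
  odd (turn (swap_values v x) a + turn (swap_values v x) b) = odd (turn x a + turn x b).
Proof.
move=> vN /andP[a0 aN] /andP[b0 bN]; have /negPf := pos_neqS x vN.
rewrite -/a -/b -val_eqE /= => ab; rewrite !oddD !oddb /turn a0 aN b0 bN /=.
by rewrite !asc_swap_values -/a -/b //; lia.
Qed.

Lemma pos_swap_values_id v w x : v < N -> w <= N -> w != v -> w != v.+1 ->
  pos (swap_values v x) w = pos x w.
Proof.
move=> vN wN wv wv1; rewrite /pos invMg permM tpermV tpermD //.
all: by rewrite -val_eqE /= !inordK // 1?ltnW // eq_sym.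
Qed.

Lemma pos_swap_valuesL v x : pos (swap_values v x) v = pos x v.+1.
Proof. by rewrite /pos invMg permM tpermV tpermL. Qed.

Lemma pos_swap_valuesR v x : pos (swap_values v x) v.+1 = pos x v.
Proof. by rewrite /pos invMg permM tpermV tpermR. Qed.

Lemma swap_valuesC v w x : v.+1 < w -> w < N ->
  swap_values v (swap_values w x) = swap_values w (swap_values v x).
Proof.
move=> vw wN; rewrite /swap_values -!mulgA; congr (_ * _)%g.
apply/esym/commgP/conjg_fixP; rewrite tpermJ !tpermD //.
all: by rewrite -val_eqE /= !inordK // ?ltnS; lia.
Qed.

Lemma swap_valuesK v : involutive (swap_values v).
Proof. by move=> x; rewrite /swap_values -mulgA tperm2 mulg1. Qed.

Lemma sum_turn_values x :
  \sum_(p < N.+1) turn x p =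
  \sum_(i < (N.+1)./2) (turn x (pos x i.*2) + turn x (pos x i.*2.+1)) +
  odd N.+1 * turn x (pos x N).
Proof.
rewrite (reindex_inj (@perm_inj _ x^-1%g)).
rewrite (eq_bigr (fun v : 'I_N.+1 => turn x (pos x v) : nat)) => [|v _]; last first.
  by rewrite /pos inord_val.
rewrite -(sum_double (fun v => turn x (pos x v) : nat)).
rewrite -!(big_mkord xpredT (fun v => turn x (pos x v) : nat)).
have NE := odd_double_half N.+1; move: NE; case: (odd N.+1) => NE.
  have -> : (N.+1)./2.*2 = N by lia.
  by rewrite big_nat_recr //= mul1n.
by rewrite mul0n addn0; congr (\sum_(0 <= _ < _) _); lia.
Qed.

Local Open Scope ring_scope.
Local Notation q := ('X - (-1)%:P : {poly rat}).

Lemma card_pred_val_eq m a : (#|[pred i : 'I_m | i == a :> nat]| <= 1)%N.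
Proof.
by apply/card_le1_eqP => i j; rewrite !inE => /eqP ia /eqP ja; apply: ord_inj; rewrite ia.
Qed.

Lemma dvdp_sum_signed_altruns :
  q ^+ ((N.+1)./2 - 2) %| \sum_(x : 'S_N.+1) (-1) ^+ inv x *: 'X^(altruns x).
Proof.
set m := (N.+1)./2.
have mN (i : 'I_m) : (i.*2 < N)%N by have := ltn_ord i; rewrite /m; lia.
pose F (i : 'I_m) x : {poly rat} := 'X^(turn x (pos x i.*2) + turn x (pos x i.*2.+1)).
(* For odd n the top value N has no partner, and no swap moves it. *)
pose G x : {poly rat} := (-1) ^+ odd (inv x) *: 'X^((odd N.+1 * turn x (pos x N)).+1).
have XE x : (-1) ^+ inv x *: 'X^(altruns x) = G x * \prod_i F i x.
  rewrite altruns_turns sum_turn_values -addnS exprD -scalerAl signr_odd mulrC.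
  by rewrite expr_sum.
have := @sum_prod_orbit _ _ _ (-1) (fun (i : 'I_m) => swap_values i.*2) F G.
rewrite -(eq_bigr _ (fun x _ => XE x)) => orb.
suff: q ^+ (m - 2) %| (\sum_(x : 'S_N.+1) (-1) ^+ inv x *: 'X^(altruns x)) *+ 2 ^ #|'I_m|.
  by rewrite -scaler_nat dvdpZr // pnatr_eq0 -lt0n expn_gt0.
rewrite orb => [|i|i j x|i j x ij|i x].
- elim/big_ind: _ => [|a b|x _]; [exact: dvdp0|exact: dvdp_add|apply: dvdp_mull].
  (* These index the pairs that hold the first and last letters; the pairs in P lie in the interior.
     At most two are lost: a and b may coincide, or be out of range when the letter is the unpaired
     N. *)
  pose a := (x ord0)./2; pose b := (x ord_max)./2.
  pose P := [pred i : 'I_m | (i != a :> nat) && (i != b :> nat)].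
  apply: (@dvdp_trans _ (q ^+ #|P|)).
    apply: dvdp_exp2l; rewrite leq_subLR -[X in (X <= _)%N]card_ord -(cardC P) addnC leq_add2r.
    rewrite -[2%N]/(1 + 1)%N; apply: leq_trans (leq_add (card_pred_val_eq m a) (card_pred_val_eq m b)).
    rewrite -cardUI; apply: leq_trans (leq_addr _ _); apply/subset_leq_card/subsetP => i.
    by rewrite !inE negb_and !negbK.
  apply: dvdp_exp_prod => i /andP[ia ib].
  rewrite mulN1r; apply: dvdp_XnBXn.
  have inner v : (v <= N)%N -> v./2 = i -> (0 < pos x v < N)%N.
    move=> vN vi; have := ltn_ord (pos x v); rewrite ltnS => le_pN.
    rewrite lt0n [(_ < N)%N]ltn_neqAle le_pN andbT.
    apply/andP; split.
    - apply: contra ia => /eqP p0; rewrite -vi /a.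
      have: ord0 == pos x v by rewrite -val_eqE /= p0.
      by rewrite -pos_eq // => /eqP->.
    - apply: contra ib => /eqP pN; rewrite -vi /b.
      have: ord_max == pos x v by rewrite -val_eqE /= pN.
      by rewrite -pos_eq // => /eqP->.
  rewrite pos_swap_valuesL pos_swap_valuesR [X in (_ + X)%N]addnC.
  rewrite oddD odd_turns_swap_values ?mN ?inner ?addbb //; have := mN i; lia.
- exact: inv_inj (@swap_valuesK _).
- have [->//|ij] := eqVneq i j.
  have {}ij : i <> j :> nat by move=> ji; case/eqP: ij; apply: ord_inj.
  case: (ltngtP i j) => // lt; [|apply/esym]; apply: swap_valuesC; rewrite ?mN //; lia.
- have {}ij : j <> i :> nat by move=> ji; case/eqP: ij; apply: ord_inj.
  have [miN mjN] := (mN i, mN j).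
  rewrite /F !pos_swap_values_id //; try lia.
  rewrite !turn_swap_values // val_eqE (inj_eq perm_inj) -val_eqE /= !inordK ?ltnS //; lia.
- rewrite /G odd_inv_swap_values ?mN // signrN scaleNr mulN1r.
  case: (boolP (odd N.+1)) => oN; last by rewrite !mul0n.
  have miN : (i.*2.+1 < N)%N by have := ltn_ord i; rewrite /m; lia.
  rewrite pos_swap_values_id ?turn_swap_values //; try lia.
  all: rewrite val_eqE (inj_eq perm_inj) -val_eqE /= !inordK ?ltnS //; lia.
Qed.

End Sign.

(** * Complementation of values, which makes Q vanish when n is 2 or 3 mod 4 *)

Lemma sum_ltn_pairs n : \sum_(p : 'I_n * 'I_n | p.1 < p.2) 1 = 'C(n, 2).
Proof.
rewrite -(pair_big_dep xpredT (fun i j : 'I_n => i < j) (fun _ _ => 1)) /=.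
rewrite (exchange_big_dep xpredT) //= -bin2_sum big_mkord.
by apply: eq_bigr => j _; rewrite (big_ord_narrow (ltnW (ltn_ord j))) sum1_card card_ord.
Qed.

Lemma odd_bin2 n : odd 'C(n, 2) = (n %% 4 == 2) || (n %% 4 == 3).
Proof.
rewrite bin2 {1 2}(divn_eq n 4); move: (n %/ 4) (n %% 4) (ltn_pmod n (isT : 0 < 4)) => a r.
case: r => [|[|[|[|//]]]] _ /=.
- have -> : (a * 4 + 0) * (a * 4 + 0).-1 = (a * (a * 4).-1).*2.*2 by lia.
  by rewrite doubleK odd_double.
- have -> : (a * 4 + 1) * (a * 4 + 1).-1 = (a * (a * 4 + 1)).*2.*2 by lia.
  by rewrite doubleK odd_double.
- have -> : (a * 4 + 2) * (a * 4 + 2).-1 = ((a.*2 + 1) * (a * 4 + 1)).*2 by lia.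
  by rewrite doubleK oddM !oddD odd_double oddM andbF.
- have -> : (a * 4 + 3) * (a * 4 + 3).-1 = ((a * 4 + 3) * (a.*2 + 1)).*2 by lia.
  by rewrite doubleK oddM !oddD odd_double oddM andbF.
Qed.

Section Complement.
Variable N : nat.

Lemma altruns_rev_suffix0 (x : 'S_N.+1) : altruns (rev_suffix 0 x) = altruns x.
Proof.
rewrite !altruns_turns; congr _.+1; apply: eq_bigr => -[[|p] pN] _ //.
by rewrite turn_rev_suffix //; right.
Qed.

(** The suffix from 0 is the whole word, so this map complements the values and flips all pairs. *)
Lemma odd_inv_rev_suffix0 (x : 'S_N.+1) :
  odd (inv (rev_suffix 0 x)) = odd (inv x) (+) odd 'C(N.+1, 2).
Proof.
rewrite (@odd_inv_addb _ x _ (fun _ _ => true)) ?sum_ltn_pairs // => a b ab.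
rewrite !permM rev_perm_lt ?imset_f ?inE // addbT -perm_ltNge ?negbK //.
by rewrite -val_eqE /= neq_ltn ab orbT.
Qed.

Local Open Scope ring_scope.

Lemma sum_signed_altruns_eq0 (f : nat -> rat) : odd 'C(N.+1, 2) ->
  \sum_(x : 'S_N.+1) (-1) ^+ inv x * f (altruns x) = 0.
Proof.
move=> oC; set S := \sum_x _; suff: S = - S.
  by move/eqP; rewrite -addr_eq0 -mulr2n mulrn_eq0 => /eqP.
rewrite {1}/S (reindex_inj (inv_inj (@rev_suffixK N 0))) -sumrN.
apply: eq_bigr => x _; rewrite altruns_rev_suffix0 -mulNr; congr (_ * _).
by rewrite -signr_odd odd_inv_rev_suffix0 oC addbT signrN signr_odd.
Qed.

End Complement.

(** * Vanishing alternating moments, and the passage to each sign class *)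

Section Moments.
Local Open Scope ring_scope.

Lemma altruns_moment n k : (0 < n)%N -> (2 * k + 4 <= n)%N ->
  \sum_(x : 'S_n) (-1) ^+ altruns x * (altruns x)%:R ^+ k = 0 :> rat.
Proof.
case: n => // N _ kN.
rewrite -[RHS](@sum_signed_pow_eq0 _ (fun=> 1) (@altruns N.+1) k).
  by apply: eq_bigr => x _; rewrite mul1r.
under eq_bigr do rewrite scale1r.
by apply: dvdp_trans (dvdp_sum_altruns N); apply: dvdp_exp2l; lia.
Qed.

Lemma signed_altruns_moment n k : (0 < n)%N ->
  (odd 'C(n, 2) || (2 * k + 6 <= n)%N) ->
  \sum_(x : 'S_n) (-1) ^+ inv x * ((-1) ^+ altruns x * (altruns x)%:R ^+ k) = 0 :> rat.
Proof.
case: n => // N _ /orP[oC|kN].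
  exact: (sum_signed_altruns_eq0 (fun a => (-1) ^+ a * a%:R ^+ k)).
rewrite -[RHS](@sum_signed_pow_eq0 _ (fun x : 'S_N.+1 => (-1) ^+ inv x) (@altruns N.+1) k).
  by apply: eq_bigr => x _; rewrite mulrA.
by apply: dvdp_trans (dvdp_sum_signed_altruns N); apply: dvdp_exp2l; lia.
Qed.

(** The indicator of a sign class is half of 1 plus or minus the sign of the permutation. *)
Lemma sum_R (f : nat -> rat) (eps : bool) n : (0 < n)%N ->
  \sum_(1 <= j < n.+1) f j * (R eps n j)%:R =
  2^-1 * (\sum_(x : 'S_n) f (altruns x) +
          (-1) ^+ (~~ eps) * \sum_(x : 'S_n) (-1) ^+ inv x * f (altruns x)).
Proof.
move=> n0; transitivity (\sum_(x in signed_perms eps n) f (altruns x)).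
  pose J j := [set s in signed_perms eps n | altruns s == j].
  have RE j : f j * (R eps n j)%:R = \sum_(x in signed_perms eps n | altruns x == j) f (altruns x).
    rewrite /R -sum1_card natr_sum mulr_sumr; apply: eq_big => [x|x]; first by rewrite inE.
    by rewrite inE => /andP[_ /eqP->]; rewrite mulr1.
  rewrite (eq_bigr _ (fun j _ => RE j)) (exchange_big_dep (mem (signed_perms eps n))) /=.
    apply: eq_bigr => x xs; rewrite xs /= big_mkcond (bigD1_seq (altruns x)) ?iota_uniq //=.
      by rewrite eqxx big1 ?addr0 // => j; rewrite eq_sym => /negPf->.
    by rewrite mem_index_iota ltnS altruns_le // /altruns addn1.
  by move=> j x _ /andP[].
rewrite big_mkcond mulr_sumr -big_split mulr_sumr; apply: eq_bigr => x _ /=.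
rewrite -(signr_odd _ (inv x)) mulrA -signr_addb.
have -> : (x \in signed_perms eps n) = ~~ (~~ eps (+) odd (inv x)).
  by case: eps; rewrite !inE ?negbK.
case: (_ (+) _); first by rewrite mulN1r subrr mulr0.
by rewrite mul1r -mulr2n -[f _ *+ 2]mulr_natl mulrA mulVf ?mul1r.
Qed.
End Moments.

Theorem theorem5 (n k : nat) (hn : 0 < n) (hk : 0 < k)
  (hnk : ((n = 0 %[mod 4] \/ n = 1 %[mod 4]) /\ 2 * k + 6 <= n) \/
         ((n = 2 %[mod 4] \/ n = 3 %[mod 4]) /\ 2 * k + 4 <= n))
  (eps : bool) :
  \sum_(1 <= j < n.+1 | odd j) j ^ k * R eps n j =
  \sum_(1 <= j < n.+1 | ~~ odd j) j ^ k * R eps n j.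
Proof.
have kn : 2 * k + 4 <= n by lia.
have kn' : odd 'C(n, 2) || (2 * k + 6 <= n).
  by rewrite odd_bin2; case: hnk => -[] [] ->; rewrite ?orbT => // ->; rewrite orbT.
have := sum_R (fun j => (-1) ^+ j * j%:R ^+ k)%R eps hn.
rewrite altruns_moment // signed_altruns_moment // mulr0 addr0 mulr0.
rewrite (bigID odd) /= => /eqP; rewrite addrC addr_eq0 -sumrN => /eqP alt0.
apply/eqP; rewrite -(eqr_nat rat) !natr_sum; apply/eqP/esym.
transitivity (\sum_(1 <= j < n.+1 | ~~ odd j) (-1) ^+ j * j%:R ^+ k * (R eps n j)%:R : rat)%R.
  by apply: eq_bigr => j /negPf oj; rewrite -signr_odd oj mul1r natrM natrX.
rewrite alt0; apply: eq_bigr => j oj.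
by rewrite -signr_odd oj mulN1r mulNr opprK natrM natrX.
Qed.
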